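(* Let $\mathcal X$ be a Cartesian grid on $\mathcal D=[a,b]\times[c,d]$, covered by overlapping local Cartesian subgrids $\mathcal X_1,\dots,\mathcal X_M$, each of size $n_x\times n_y$ with $n_x=m_x+1$ and $n_y=m_y+1$, and let $\mathcal I_k$ and $\mathcal G[\cdot,\mathcal X]$ be the associated local interpolation operators and global operator (all as defined in the context). Let $$q\in\mathbb P_{m_x,m_y}=\operatorname{span}\{x^\alpha y^\beta:\ 0\le\alpha\le m_x,\ 0\le\beta\le m_y\}.$$ Then $$\mathcal I_k[q](\mathbf x)=q(\mathbf x),\qquad k=1,\dots,M,\quad \mathbf x\in\mathbb R^2,$$ and hence $$\mathcal G[q,\mathcal X](\mathbf x)=q(\mathbf x),\qquad \mathbf x\in\mathcal D.$$
   Context: Grid. $\mathcal X=\{(x_i,y_j):1\le i\le N_x,\ 1\le j\le N_y\}$ with $a=x_1<\dots<x_{N_x}=b$ and $c=y_1<\dots<y_{N_y}=d$. Subgrids. Fix $2\le n_x\le N_x$, $2\le n_y\le N_y$ and steps $1\le\rho_x\le n_x-1$, $1\le\rho_y\le n_y-1$. The starting indices $i_1<\dots<i_{M_x}$ and $j_1<\dots<j_{M_y}$ satisfy $i_{p+1}=i_p+\rho_x$, $j_{q+1}=j_q+\rho_y$, $i_p+n_x-1\le N_x$, $j_q+n_y-1\le N_y$. The subgrids are $\{(x_{i_p+r},y_{j_q+s}):0\le r\le n_x-1,\ 0\le s\le n_y-1\}$, for $1\le p\le M_x$, $1\le q\le M_y$, numbered as $\mathcal X_1,\dots,\mathcal X_M$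 with $M=M_xM_y$. Adjacent subgrids thus overlap (share grid nodes), and it is assumed that $\bigcup_{k=1}^M\mathcal X_k=\mathcal X$. Local interpolants. Write $\mathcal X_k=\{(x_r^k,y_s^k):1\le r\le n_x,1\le s\le n_y\}$ and let $\ell_{x,r}^k,\ell_{y,s}^k$ be the one-dimensional Lagrange basis polynomials for the nodes $\{x_r^k\}_r$ and $\{y_s^k\}_s$. For $\mathbf x=(x,y)\in\mathbb R^2$, $$\mathcal I_k[u](\mathbf x)=\sum_{r=1}^{n_x}\sum_{s=1}^{n_y}u(x_r^k,y_s^k)\,\ell_{x,r}^k(x)\,\ell_{y,s}^k(y).$$ Weights. Fix $\mu>2$ and set $$\mathcal W_k(\mathbf x)=\frac{\omega_k(\mathbf x)}{\sum_{l=1}^M\omega_l(\mathbf x)},\qquad \omega_k(\mathbf x)=\prod_{\mathbf x'\in\mathcal X_k}\|\mathbf x-\mathbf x'\|^{-\mu}$$ (Euclidean norm), extended to the nodes by continuity; equivalently, for all $\mathbf x\in\mathbb R^2$, $$\mathcal W_k(\mathbf x)=\frac{\prod_{\mathbf x'\in\mathcal X\setminus\mathcal X_k}\|\mathbf x-\mathbf x'\|^{\mu}}{\sum_{l=1}^M\prod_{\mathbf x'\in\mathcal X\setminus\mathcal X_l}\|\mathbf x-\mathbf x'\|^{\mu}}.$$ Global operator: $\mathcal G[u,\mathcal X](\mathbf x)=\sum_{k=1}^M\mathcal W_k(\mathbf x)\,\mathcal I_k[u](\mathbf x)$. *)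

(* Defs.v *)
From HB Require Import structures.
From mathcomp Require Import all_boot all_order all_algebra.
From mathcomp Require Import qpoly.
From mathcomp Require Import all_classical all_reals all_analysis.

Set Implicit Arguments.
Unset Strict Implicit.
Unset Printing Implicit Defensive.

Import Order.TTheory GRing.Theory Num.Theory.
Import numFieldNormedType.Exports.

Local Open Scope classical_set_scope.
Local Open Scope ring_scope.

(* All indices are 0-based: x`_i is the (i+1)-st coordinate, and a block of n
   consecutive nodes starting at index i is x`_i, ..., x`_(i + n - 1). *)

Definition axis_nodes (R : realType) (N : nat) (x : N.-tuple R) (a b : R) :=
  [/\ sorted <%R x, x`_0 = a & x`_N.-1 = b].

Definition grid (R : realType) (Nx Ny : nat) (x : Nx.-tuple R)
    (y : Ny.-tuple R) : seq (R * R) :=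
  [seq (s, t) | s <- x, t <- y].

Definition block_starts (N n rho M : nat) (i : 'I_M -> nat) :=
  [/\ forall p p' : 'I_M, (p < p')%N -> (i p < i p')%N,
      forall p p' : 'I_M, p' = p.+1 :> nat -> i p' = (i p + rho)%N
    & forall p : 'I_M, (i p + n <= N)%N].

(* The M = Mx * My subgrids are numbered by pairs k : 'I_Mx * 'I_My. *)
Definition subgrid (R : realType) (Nx Ny : nat) (x : Nx.-tuple R)
    (y : Ny.-tuple R) (nx ny Mx My : nat) (i : 'I_Mx -> nat) (j : 'I_My -> nat)
    (k : 'I_Mx * 'I_My) : seq (R * R) :=
  [seq (x`_(i k.1 + r)%N, y`_(j k.2 + s)%N) | r <- iota 0 nx, s <- iota 0 ny].

(* tnth (lagrange n t) r is the r-th Lagrange basis polynomial, of degree n - 1,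
   for the nodes t 0, ..., t (n - 1); the other values of t are not used. *)
Definition local_interp (R : realType) (Nx Ny : nat) (x : Nx.-tuple R)
    (y : Ny.-tuple R) (nx ny Mx My : nat) (i : 'I_Mx -> nat) (j : 'I_My -> nat)
    (k : 'I_Mx * 'I_My) (u : R * R -> R) (z : R * R) : R :=
  let xk := fun r => x`_(i k.1 + r)%N in
  let yk := fun s => y`_(j k.2 + s)%N in
  \sum_(r < nx) \sum_(s < ny)
    u (xk r, yk s) * (tnth (lagrange nx xk) r).[z.1]
                   * (tnth (lagrange ny yk) s).[z.2].

(* The norm of the product R * R is the sup norm, hence this distance. *)
Definition eucl_dist (R : realType) (z w : R * R) : R :=
  Num.sqrt ((z.1 - w.1) ^+ 2 + (z.2 - w.2) ^+ 2).

Definition omega (R : realType) (Nx Ny : nat) (x : Nx.-tuple R)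
    (y : Ny.-tuple R) (nx ny Mx My : nat) (i : 'I_Mx -> nat) (j : 'I_My -> nat)
    (mu : R) (k : 'I_Mx * 'I_My) (z : R * R) : R :=
  \prod_(w <- subgrid x y nx ny i j k) eucl_dist z w `^ (- mu).

Definition omega_ratio (R : realType) (Nx Ny : nat) (x : Nx.-tuple R)
    (y : Ny.-tuple R) (nx ny Mx My : nat) (i : 'I_Mx -> nat) (j : 'I_My -> nat)
    (mu : R) (k : 'I_Mx * 'I_My) (z : R * R) : R :=
  omega x y nx ny i j mu k z / \sum_l omega x y nx ny i j mu l z.

(* omega is singular at the nodes (where 0 `^ (- mu) is a junk value): there
   the weight is the limit of the ratio at z along points other than z. *)
Definition weight (R : realType) (Nx Ny : nat) (x : Nx.-tuple R)
    (y : Ny.-tuple R) (nx ny Mx My : nat) (i : 'I_Mx -> nat) (j : 'I_My -> nat)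
    (mu : R) (k : 'I_Mx * 'I_My) (z : R * R) : R :=
  if z \in grid x y then lim (omega_ratio x y nx ny i j mu k w @[w --> z^'])
  else omega_ratio x y nx ny i j mu k z.

Definition global_interp (R : realType) (Nx Ny : nat) (x : Nx.-tuple R)
    (y : Ny.-tuple R) (nx ny Mx My : nat) (i : 'I_Mx -> nat) (j : 'I_My -> nat)
    (mu : R) (u : R * R -> R) (z : R * R) : R :=
  \sum_k weight x y nx ny i j mu k z * local_interp x y nx ny i j k u z.

Definition bipoly (R : realType) (mx my : nat) : set (R * R -> R) :=
  [set q | exists c : 'M[R]_(mx.+1, my.+1),
    q = fun z => \sum_al \sum_be c al be * (z.1 ^+ al * z.2 ^+ be)].

(* Main.v *)
(* Tensor-product Lagrange interpolation on nx x ny distinct nodes is exact on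
   monomials of degree < nx in x and < ny in y, and the weights add up to 1: off
   the grid by construction, and at a node z because, once numerator and
   denominator are multiplied by the mu-th power of the distance to z, every
   term has a limit, which is positive exactly for the subgrids containing z. *)

Require Import Defs.
From HB Require Import structures.
From mathcomp Require Import all_boot all_order all_algebra.
From mathcomp Require Import qpoly.
From mathcomp Require Import all_classical all_reals all_analysis.

Import Order.TTheory GRing.Theory Num.Theory.
Import numFieldNormedType.Exports.

Local Open Scope classical_set_scope.
Local Open Scope ring_scope.

Lemma eq_lagrange (K : fieldType) (n : nat) (t t' : nat -> K) :
  (forall r, (r < n)%N -> t r = t' r) -> lagrange n t = lagrange n t'.
Proof.
move=> tt'; apply: eq_from_tnth => r.
rewrite [lagrange n t]unlock [lagrange n t']unlock !tnth_map tnth_ord_tuple.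
rewrite /= tt' //; have -> // : \prod_(s < n | s != r) ('X - (t s)%:P) =
  \prod_(s < n | s != r) ('X - (t' s)%:P).
by apply: eq_bigr => s _; rewrite tt'.
Qed.

(* [lagrange_gen] wants nodes injective on all of nat, whereas only the first n
   are distinct here: the others are replaced by large distinct values. *)
Lemma lagrange_gen_in (K : realFieldType) (n : nat) (t : nat -> K)
    (p : {poly K}) :
  (0 < n)%N -> {in gtn n &, injective t} -> (size p <= n)%N ->
  p = \sum_(r < n) p.[t r]%:P * tnth (lagrange n t) r.
Proof.
(* The [+ 1] puts [B] strictly above every genuine node, so no replacement value [B + s%:R] can
   collide with one. *)
move=> n0 tinj sp; pose B : K := \sum_(r < n) `|t r| + 1.
pose t' r := if (r < n)%N then t r else B + r%:R.
have tB r s : (r < n)%N -> t r != B + s%:R.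
  move=> rn; rewrite lt_eqF // /B (bigD1 (Ordinal rn)) //= -!addrA.
  apply: (le_lt_trans (ler_norm _)); rewrite ltrDl.
  by rewrite ltr_wpDl ?sumr_ge0 // ltr_wpDr.
have t'inj : injective t'.
  move=> r s; rewrite /t'; case: ltnP => rn; case: ltnP => sn.
  - exact: tinj.
  - by move/eqP; rewrite (negPf (tB _ _ rn)).
  - by move/esym/eqP; rewrite (negPf (tB _ _ sn)).
  - by move/addrI/eqP; rewrite eqr_nat => /eqP.
have tt' r : (r < n)%N -> t r = t' r by move=> rn; rewrite /t' rn.
rewrite [LHS](lagrange_gen n0 t'inj sp) (eq_lagrange _ _ _ _ tt').
by apply: eq_bigr => r _; rewrite tt'.
Qed.

(** This is the interpolation formula for ['X^e], a polynomial of size [e + 1], evaluated at [v]. *)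
Lemma lagrange_exprn (K : realFieldType) (n : nat) (t : nat -> K) (e : nat)
    (v : K) :
  {in gtn n &, injective t} -> (e < n)%N ->
  \sum_(r < n) t r ^+ e * (tnth (lagrange n t) r).[v] = v ^+ e.
Proof.
move=> tinj en; rewrite -[RHS]hornerXn.
rewrite [in RHS](lagrange_gen_in _ _ _ 'X^e (leq_ltn_trans (leq0n e) en) tinj);
  last by rewrite size_polyXn.
by rewrite horner_sum; apply: eq_bigr => r _; rewrite hornerM hornerC hornerXn.
Qed.

(** The bound [i + n <= N] keeps every index inside the tuple; past its end [nth] returns the
    default 0 and values could repeat. *)
Lemma sorted_block_inj (R : realType) (N n i : nat) (x : N.-tuple R) :
  sorted <%R x -> (i + n <= N)%N ->
  {in gtn n &, injective (fun r => x`_(i + r)%N)}.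
Proof.
move=> xs iN r s; rewrite !inE => rn sn /eqP.
rewrite nth_uniq ?size_tuple ?(lt_sorted_uniq xs) //.
- by rewrite eqn_add2l => /eqP.
- by rewrite (leq_trans _ iN) // ltn_add2l.
- by rewrite (leq_trans _ iN) // ltn_add2l.
Qed.

Section LocalInterpolation.

Variables (R : realType) (Nx Ny : nat) (x : Nx.-tuple R) (y : Ny.-tuple R).
Variables (nx ny Mx My : nat) (i : 'I_Mx -> nat) (j : 'I_My -> nat).
Hypotheses (sx : sorted <%R x) (sy : sorted <%R y).
Hypotheses (iN : forall p, (i p + nx <= Nx)%N).
Hypotheses (jN : forall p, (j p + ny <= Ny)%N).

(** Each node thus contributes a single factor to [omega], so one power of the distance is enough to
    cancel the singularity there. *)
Lemma uniq_subgrid k : uniq (subgrid x y nx ny i j k).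
Proof.
have inP t : t \in [seq (r, s) | r <- iota 0 nx, s <- iota 0 ny] ->
    t.1 \in gtn nx /\ t.2 \in gtn ny.
  by case/allpairsP=> -[r s] [+ + ->]; rewrite !mem_iota.
apply: allpairs_uniq; rewrite ?iota_uniq // => t t' /inP[rn sn] /inP[rn' sn'].
case: t t' => [r s] [r' s'] in rn sn rn' sn' * => -[].
move=> /(sorted_block_inj _ _ _ _ _ sx (iN _) _ _ rn rn')/= ->.
by move=> /(sorted_block_inj _ _ _ _ _ sy (jN _) _ _ sn sn')/= ->.
Qed.

Lemma local_interp_bipoly mx my k q z :
  (mx < nx)%N -> (my < ny)%N -> bipoly mx my q ->
  local_interp x y nx ny i j k q z = q z.
Proof.
move=> mxn myn [c ->]; rewrite /local_interp /=.
have xinj := sorted_block_inj _ _ _ _ _ sx (iN k.1).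
have yinj := sorted_block_inj _ _ _ _ _ sy (jN k.2).
(* Each monomial of [q] becomes a product of two univariate Lagrange sums; the exchanges of sums
   below then bring [r] and [s] outermost, as in [local_interp]. *)
under [RHS]eq_bigr => al _ do under eq_bigr => be _ do
  rewrite -(lagrange_exprn _ nx _ _ _ xinj (leq_trans (ltn_ord al) mxn))
    -(lagrange_exprn _ ny _ _ _ yinj (leq_trans (ltn_ord be) myn))
    big_distrlr mulr_sumr.
under [RHS]eq_bigr => al _ do rewrite exchange_big.
rewrite [RHS]exchange_big; apply: eq_bigr => r _ /=.
under [RHS]eq_bigr => al _ do under eq_bigr => be _ do rewrite mulr_sumr.
under [RHS]eq_bigr => al _ do rewrite exchange_big.
rewrite [RHS]exchange_big; apply: eq_bigr => s _ /=.
rewrite -mulrA mulr_suml; apply: eq_bigr => al _.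
rewrite mulr_suml; apply: eq_bigr => be _.
by rewrite -!mulrA; congr (_ * (_ * _)); rewrite mulrCA.
Qed.

End LocalInterpolation.

Section EuclideanDistance.

Variable R : realType.
Implicit Types (p w z : R * R) (mu : R) (s : seq (R * R)).

Lemma eucl_dist_gt0 z w : (0 < eucl_dist z w) = (z != w).
Proof.
rewrite sqrtr_gt0 lt0r addr_ge0 ?sqr_ge0 // andbT.
rewrite paddr_eq0 ?sqr_ge0 // !sqrf_eq0 !subr_eq0 -xpair_eqE.
by rewrite -!surjective_pairing.
Qed.

Lemma eucl_distxx z : eucl_dist z z = 0.
Proof. by rewrite /eucl_dist !subrr expr0n addr0 sqrtr0. Qed.

Lemma eucl_dist_continuous p : continuous (fun w : R * R => eucl_dist w p).
Proof.
move=> w; apply: continuous_cvg; first exact: sqrt_continuous.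
have sq_cvg (f : R * R -> R) (a : R) : f v @[v --> w] --> f w ->
    (f v - a) ^+ 2 @[v --> w] --> (f w - a) ^+ 2.
  move=> fw; rewrite expr2; under eq_cvg do rewrite expr2.
  by apply: cvgM; apply: cvgB => //; exact: cvg_cst.
by apply: cvgD; apply: sq_cvg; [exact: cvg_fst|exact: cvg_snd].
Qed.

Lemma powR_continuous (r a : R) : 0 < a -> {for a, continuous ((@powR R)^~ r)}.
Proof.
move=> a0; apply: differentiable_continuous; apply/derivable1_diffP.
by apply: derivable_powR; rewrite in_itv /= a0.
Qed.

(** No point of the plane is isolated; properness makes limits along [z^'] unique, so that [lim] can
    be computed. *)
Lemma dnbhs_prod_proper z : ProperFilter z^'.
Proof.
apply: Build_ProperFilter_ex => A /nbhs_ballP[_/posnumP[e] Ae].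
(* The witness is [z] shifted horizontally by half the radius of the ball. *)
exists (z.1 + e%:num / 2, z.2); apply: Ae; last first.
  by apply/eqP => /(congr1 fst)/= /eqP; rewrite addrC -subr_eq0 addrK gt_eqF.
split; last exact: ballxx.
by rewrite /ball /= opprD addNKr normrN ger0_norm // [ltRHS]splitr ltr_pwDl.
Qed.

Lemma cvg_eucl_dist_powR mu z : 0 < mu ->
  eucl_dist w z `^ mu @[w --> z^'] --> (0 : R).
Proof.
move=> mu0; apply: (@cvg_comp _ _ _ (fun w => eucl_dist w z)
  ((@powR R)^~ mu) _ 0^'+).
  move=> A; rewrite /at_right /= /within /= => A0.
  have := eucl_dist_continuous z z; rewrite /continuous_at eucl_distxx.
  move=> /(_ _ A0).
  rewrite /nbhs /= /dnbhs /within /=; apply: filterS => w /= + wz; apply.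
  by rewrite eucl_dist_gt0.
exact: powR_cvg0.
Qed.

Lemma cvg_prod_eucl_dist mu z s : z \notin s ->
  \prod_(p <- s) eucl_dist w p `^ (- mu) @[w --> z^'] -->
  \prod_(p <- s) eucl_dist z p `^ (- mu).
Proof.
move=> zs; under eq_cvg do rewrite big_seq; rewrite big_seq.
apply: (cvg_big (@mul_continuous R)) => p ps.
apply: (@cvg_comp _ _ _ (fun w => eucl_dist w p) ((@powR R)^~ (- mu)) _
  (nbhs (eucl_dist z p))).
  by apply: cvg_within_filter; apply: eucl_dist_continuous.
by apply: powR_continuous; rewrite eucl_dist_gt0; apply: contraNneq zs => ->.
Qed.

(** If [z] is in [s], the scaling cancels its singular factor and the rest is continuous at [z];
    otherwise the product converges and the scaling tends to 0. The indicator [(z \in s)%:R] merges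
    both cases. *)
Lemma cvg_scaled_prod_eucl_dist mu z s : 0 < mu -> uniq s ->
  (\prod_(p <- s) eucl_dist w p `^ (- mu)) * eucl_dist w z `^ mu
    @[w --> z^'] -->
  (\prod_(p <- rem z s) eucl_dist z p `^ (- mu)) * (z \in s)%:R.
Proof.
move=> mu0 us; have [zs|zs] := boolP (z \in s); last first.
  by rewrite rem_id //; apply: cvgM (cvg_eucl_dist_powR _ _ mu0);
    exact: cvg_prod_eucl_dist.
rewrite mulr1; have zr : z \notin rem z s by rewrite mem_rem_uniqF.
apply: cvg_trans (cvg_prod_eucl_dist mu _ _ zr).
apply: near_eq_cvg; near=> w.
rewrite (perm_big _ (perm_to_rem zs)) big_cons mulrAC powRN mulVf ?mul1r //.
by rewrite gt_eqF // powR_gt0 // eucl_dist_gt0; near: w; exact: nbhs_dnbhs_neq.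
Unshelve. all: by end_near. Qed.

Lemma prod_eucl_dist_gt0 mu z s : z \notin s ->
  0 < \prod_(p <- s) eucl_dist z p `^ (- mu).
Proof.
move=> zs; rewrite big_seq; apply: prodr_gt0 => p ps.
by rewrite powR_gt0 // eucl_dist_gt0; apply: contraNneq zs => ->.
Qed.

End EuclideanDistance.

Section Weights.

Variables (R : realType) (Nx Ny : nat) (x : Nx.-tuple R) (y : Ny.-tuple R).
Variables (nx ny Mx My : nat) (i : 'I_Mx -> nat) (j : 'I_My -> nat) (mu : R).
Hypotheses (us : forall k, uniq (subgrid x y nx ny i j k)) (mu0 : 0 < mu).

Local Notation S := (subgrid x y nx ny i j).

Lemma sum_omega_ratio z : \sum_l omega x y nx ny i j mu l z != 0 ->
  \sum_k omega_ratio x y nx ny i j mu k z = 1.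
Proof. by move=> s0; rewrite -mulr_suml mulfV. Qed.

Lemma sum_lim_omega_ratio z : (exists k, z \in S k) ->
  \sum_k lim (omega_ratio x y nx ny i j mu k w @[w --> z^']) = 1.
Proof.
move=> [k0 zk0]; have PF := dnbhs_prod_proper _ z.
(* [f k] is the rescaled numerator and [L k] its limit at [z]. *)
pose f k w := omega x y nx ny i j mu k w * eucl_dist w z `^ mu.
pose L k := (\prod_(p <- rem z (S k)) eucl_dist z p `^ (- mu)) * (z \in S k)%:R.
have rem0 k : z \notin rem z (S k) by rewrite mem_rem_uniqF.
have fL k : f k w @[w --> z^'] --> L k by exact: cvg_scaled_prod_eucl_dist.
have L0 k : 0 <= L k by rewrite mulr_ge0 // ltW // prod_eucl_dist_gt0.
(* All terms are nonnegative, and that of [k0], whose subgrid contains [z], is positive. *)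
have sL : \sum_k L k != 0.
  rewrite gt_eqF // (bigD1 k0) //= ltr_wpDr ?sumr_ge0 //.
  by rewrite /L zk0 mulr1 prod_eucl_dist_gt0.
have lim_ratio k :
    lim (omega_ratio x y nx ny i j mu k w @[w --> z^']) = L k / \sum_l L l.
  apply: cvg_lim; first exact: Rhausdorff.
  have : f k w / (\sum_l f l w) @[w --> z^'] --> L k / \sum_l L l.
    apply: cvgM => //; apply: cvgV => //.
    by apply: (cvg_big (@add_continuous R)) => // l _; exact: fL.
  (* Off [z] the scaling factor is nonzero and common to numerator and denominator, so the ratio is
     unchanged. *)
  apply: cvg_trans; apply: near_eq_cvg; near=> w.
  rewrite /omega_ratio /f -mulr_suml -mulf_div divff ?mulr1 //.
  by rewrite gt_eqF // powR_gt0 // eucl_dist_gt0; near: w; exact: nbhs_dnbhs_neq.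
by under eq_bigr do rewrite lim_ratio; rewrite -mulr_suml mulfV.
Unshelve. all: by end_near. Qed.

Hypothesis cover : forall z, (z \in grid x y) = [exists k, z \in S k].

(** The index [k0] ensures that there is a subgrid at all; an empty sum would be 0. *)
Lemma sum_weight z (k0 : 'I_Mx * 'I_My) :
  \sum_k weight x y nx ny i j mu k z = 1.
Proof.
rewrite /weight; have [zg|zg] := boolP (z \in grid x y).
  by apply: sum_lim_omega_ratio; apply/existsP; rewrite -cover.
apply: sum_omega_ratio.
(* By [cover], a point off the grid lies in no subgrid, so all its distances to nodes are
   positive. *)
have omega0 k : 0 < omega x y nx ny i j mu k z.
  apply: prod_eucl_dist_gt0; apply: contra zg; rewrite cover => zk.
  by apply/existsP; exists k.
by rewrite gt_eqF // (bigD1 k0) //= ltr_wpDr // sumr_ge0 // => k _; exact/ltW.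
Qed.

End Weights.

Theorem proposition3 (R : realType) (a b c d : R)
  (Nx Ny : nat) (x : Nx.-tuple R) (y : Ny.-tuple R)
  (hx : axis_nodes x a b) (hy : axis_nodes y c d)
  (mx my nx ny : nat) (hmx : nx = mx.+1) (hmy : ny = my.+1)
  (hnx : (2 <= nx <= Nx)%N) (hny : (2 <= ny <= Ny)%N)
  (rhox rhoy : nat)
  (hrhox : (1 <= rhox <= nx.-1)%N) (hrhoy : (1 <= rhoy <= ny.-1)%N)
  (Mx My : nat) (i : 'I_Mx -> nat) (j : 'I_My -> nat)
  (hi : block_starts Nx nx rhox i) (hj : block_starts Ny ny rhoy j)
  (hcover : \bigcup_(k in [set: 'I_Mx * 'I_My])
              [set` subgrid x y nx ny i j k] = [set` grid x y])
  (mu : R) (hmu : 2 < mu)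
  (q : R * R -> R) (hq : bipoly mx my q) :
  (forall (k : 'I_Mx * 'I_My) (z : R * R),
     local_interp x y nx ny i j k q z = q z) /\
  (forall z : R * R, a <= z.1 <= b -> c <= z.2 <= d ->
     global_interp x y nx ny i j mu q z = q z).
Proof.
case: hx hy hi hj => sx _ _ [sy _ _] [_ _ iN] [_ _ jN].
have localq k z : local_interp x y nx ny i j k q z = q z.
  have := local_interp_bipoly _ _ _ x y nx ny _ _ i j sx sy iN jN mx my k q z.
  by apply; rewrite ?hmx ?hmy.
split => // z _ _; rewrite /global_interp.
under eq_bigr do rewrite localq.
have cover w : (w \in grid x y) = [exists k, w \in subgrid x y nx ny i j k].
  apply/idP/existsP => [wg|[k wk]].
    by have [k _ wk] : (\bigcup_(k in [set: 'I_Mx * 'I_My])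
      [set` subgrid x y nx ny i j k]) w; [rewrite hcover | exists k].
  by have : [set` grid x y] w by rewrite -hcover; exists k.
(* The corner node must be covered by some subgrid, which supplies the index required by
   [sum_weight]. *)
have : (x`_0, y`_0) \in grid x y.
  apply: allpairs_f; apply: mem_nth; rewrite size_tuple.
    by case/andP: hnx => n2; apply: leq_trans; exact: ltnW.
  by case/andP: hny => n2; apply: leq_trans; exact: ltnW.
rewrite cover => /existsP[k0 _].
rewrite -mulr_suml sum_weight ?mul1r // => [k|].
  exact: uniq_subgrid.
exact: lt_trans hmu.
Qed.
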